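(* Let $d\ge1$ and let $\mathbb P$ be an arbitrary probability law on $\mathbb R^d$. For any $\delta>0$ the robustified halfspace depth $D_\delta(\cdot|\mathbb P)$ satisfies: (P4) Positivity: $D_\delta(\mathbf z|\mathbb P)>0$ for all $\mathbf z\in\mathbb R^d$. (P5) Joint continuity: $D_\delta(\mathbf z|\mathbb P)$ is continuous in $(\mathbf z,\delta)\in\mathbb R^d\times(0,\infty)$. (P6) Level sets: for any $\alpha\in(0,1)$ the set $\{\mathbf z\in\mathbb R^d:D_\delta(\mathbf z|\mathbb P)=\alpha\}$ is the (topological) boundary of the upper level set $\{\mathbf z\in\mathbb R^d:D_\delta(\mathbf z|\mathbb P)\ge\alpha\}$, or both are empty.
   Context: $\|\cdot\|$ is the Euclidean norm and $\langle\cdot,\cdot\rangle$ the Euclidean inner product. For laws $\mathbb P,\mathbb P'$ on $\mathbb R^d$ (no moment assumption) the Wasserstein distance is $d_W(\mathbb P,\mathbb P')=\inf_\Pi\int\|\mathbf x-\mathbf y\|\,\Pi(\mathrm d\mathbf x,\mathrm d\mathbf y)\in[0,\infty]$, over all joint laws $\Pi$ with marginals $\mathbb P,\mathbb P'$. The robustified halfspace depth is $$D_\delta(\mathbf z|\mathbb P)=\inf_{\mathbf u\in\mathbb R^d:\|\mathbf u\|=1}\ \sup_{\mathbb P':d_W(\mathbb P',\mathbb P)\le\delta}\mathbb P'(\{\mathbf x\in\mathbb R^d:\langle\mathbf u,\mathbf x-\mathbf z\rangle\ge0\})\in[0,1].$$ *)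

(* Defs.v *)
From HB Require Import structures.
From mathcomp Require Import all_boot all_order all_algebra.
From mathcomp Require Import all_classical all_reals all_analysis.

Set Implicit Arguments.
Unset Strict Implicit.
Unset Printing Implicit Defensive.

Import Order.TTheory GRing.Theory Num.Theory.
Import numFieldNormedType.Exports.

Local Open Scope classical_set_scope.
Local Open Scope ring_scope.

Section euclidean.
Context {R : realType} {d : nat}.
Implicit Types x y : 'rV[R]_d.

Definition dotp x y : R := \sum_(i < d) x ord0 i * y ord0 i.

(* The library norm `|x| on 'rV[R]_d is the sup norm; both norms induce the
   same (product) topology. *)
Definition enorm x : R := Num.sqrt (dotp x x).

End euclidean.

Definition borel_rV (R : realType) (d : nat) :=
  g_sigma_algebraType (@open 'rV[R]_d).

Definition boundary {T : topologicalType} (A : set T) : set T :=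
  closure A `\` interior A.

Section robustified_depth.
Context {R : realType} {d : nat}.
Local Notation E := (borel_rV R d).
Implicit Types P Q : probability E R.

(* E * E carries the product sigma-algebra, which is the Borel sigma-algebra of
   R^d x R^d since R^d is second countable. *)
Definition is_coupling P Q (Pi : probability (E * E)%type R) : Prop :=
  forall A : set E, measurable A ->
    Pi (fst @^-1` A) = P A /\ Pi (snd @^-1` A) = Q A.

Definition wasserstein P Q : \bar R :=
  ereal_inf [set (\int[Pi]_w (enorm ((w.1 : 'rV[R]_d) - w.2)%R)%:E)%E
            | Pi in is_coupling P Q].

Definition halfspace (u z : 'rV[R]_d) : set E :=
  [set x : 'rV[R]_d | 0 <= dotp u (x - z)].

(* Kept in \bar R so that no finiteness is presupposed; for d >= 1 and
   delta >= 0 the values lie in [0, 1]. *)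
Definition robust_depth (delta : R) (z : 'rV[R]_d) P : \bar R :=
  ereal_inf [set ereal_sup [set Q (halfspace u z)
                           | Q in [set Q | (wasserstein Q P <= delta%:E)%E]]
            | u in [set u : 'rV[R]_d | enorm u = 1]].

End robustified_depth.

(* Main.v *)
(* Mixtures and translations of couplings control the Wasserstein distance
   without any duality. Mixing Q with P gives D_{t delta}(z) >= t D_delta(z) for
   0 <= t <= 1, and translating Q by h gives D_{delta + |h|}(z + h) >= D_delta(z);
   together they make D locally Lipschitz in (z, delta). Collapsing a ball of
   large P-mass onto its centre z puts this mass into every halfspace through z
   at finite cost; mixing the collapsed law with P gives positivity.

   For the level sets, D_delta cannot have a local minimum of value alpha < 1 at
   z. Otherwise, for each unit u, some law nearly reaches alpha on the halfspace
   through z + e u. Retracting its coupling with P by e in the direction u keeps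
   the mass of the halfspace through z and either saves a definite part of the
   cost, or almost no mass was moved by more than e and P itself nearly reaches
   alpha. In both cases the slack pays for mixing in the collapsed law, which
   lifts the depth of z above alpha uniformly in u. *)

Require Import Defs.
From HB Require Import structures.
From mathcomp Require Import all_boot all_order all_algebra.
From mathcomp Require Import all_classical all_reals all_analysis.
From mathcomp Require Import measurable_realfun ring lra.

Set Implicit Arguments.
Unset Strict Implicit.
Unset Printing Implicit Defensive.

Import Order.TTheory GRing.Theory Num.Theory.
Import numFieldNormedType.Exports.

Local Open Scope classical_set_scope.
Local Open Scope ring_scope.

(** * Euclidean structure *)

Section euclidean_theory.
Context {R : realType} {d : nat}.
Implicit Types (x y u v : 'rV[R]_d) (c : R).

Lemma dotpC x y : dotp x y = dotp y x.
Proof. by apply: eq_bigr => i _; rewrite mulrC. Qed.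

Lemma dotpDr x y v : dotp x (y + v) = dotp x y + dotp x v.
Proof. by rewrite -big_split; apply: eq_bigr => i _; rewrite mxE mulrDr. Qed.

Lemma dotpZr c x y : dotp x (c *: y) = c * dotp x y.
Proof. by rewrite mulr_sumr; apply: eq_bigr => i _; rewrite mxE mulrCA. Qed.

Lemma dotpNr x y : dotp x (- y) = - dotp x y.
Proof. by rewrite -scaleN1r dotpZr mulN1r. Qed.

Lemma dotpBr x y v : dotp x (y - v) = dotp x y - dotp x v.
Proof. by rewrite dotpDr dotpNr. Qed.

Lemma dotpp_ge0 x : 0 <= dotp x x.
Proof. by apply: sumr_ge0 => i _; rewrite -expr2 sqr_ge0. Qed.

Lemma enorm_ge0 x : 0 <= enorm x.
Proof. exact: sqrtr_ge0. Qed.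

Lemma enorm_sqr x : enorm x ^+ 2 = dotp x x.
Proof. by rewrite sqr_sqrtr// dotpp_ge0. Qed.

Lemma enorm0 : enorm (0 : 'rV[R]_d) = 0.
Proof. by rewrite /enorm /dotp big1 ?sqrtr0// => i _; rewrite mxE mul0r. Qed.

Lemma enormZ c x : enorm (c *: x) = `|c| * enorm x.
Proof.
by rewrite /enorm dotpZr dotpC dotpZr mulrA -expr2 sqrtrM ?sqr_ge0// sqrtr_sqr.
Qed.

Lemma enormN x : enorm (- x) = enorm x.
Proof. by rewrite -scaleN1r enormZ normrN1 mul1r. Qed.

Lemma enormB_sym x y : enorm (x - y) = enorm (y - x).
Proof. by rewrite -enormN opprB. Qed.

(** Cauchy-Schwarz against a unit vector: the part of [v] orthogonal to [u] has nonnegative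
    square. *)
Lemma dotp_unit_le u v : enorm u = 1 -> dotp u v <= enorm v.
Proof.
move=> u1; have uu : dotp u u = 1 by rewrite -enorm_sqr u1 expr1n.
have : 0 <= dotp (v - dotp u v *: u) (v - dotp u v *: u) by exact: dotpp_ge0.
rewrite dotpBr dotpZr ![dotp (_ - _) _]dotpC !dotpBr !dotpZr uu (dotpC v u).
rewrite -enorm_sqr => H; have : dotp u v ^+ 2 <= enorm v ^+ 2 by nra.
have := enorm_ge0 v; nra.
Qed.

Lemma coord_le_norm x i : `|x ord0 i| <= `|x|.
Proof. by rewrite -[`|x|]/(mx_norm x) mx_normrE; apply: (le_bigmax _ _ (ord0, i)). Qed.

Lemma coord_le_enorm x i : `|x ord0 i| <= enorm x.
Proof.
rewrite -(ler_pXn2r (n:=2)) ?nnegrE ?enorm_ge0// enorm_sqr real_normK ?num_real//.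
rewrite /dotp (bigD1 i)//= -expr2 lerDl sumr_ge0// => j _.
by rewrite -expr2 sqr_ge0.
Qed.

Lemma enorm_le_norm x : enorm x <= d%:R * `|x|.
Proof.
have d0 : 0 <= d%:R * `|x| by rewrite mulr_ge0.
rewrite -(ler_pXn2r (n:=2)) ?nnegrE ?enorm_ge0// enorm_sqr exprMn.
apply: (@le_trans _ _ (d%:R * `|x| ^+ 2)).
  rewrite mulr_natl -[X in _ *+ X]card_ord -sumr_const ler_sum// => i _.
  by rewrite -expr2 -real_normK ?num_real// lerXn2r ?nnegrE ?coord_le_norm.
rewrite ler_wpM2r ?sqr_ge0// -natrX ler_nat -mulnn.
by case: (d) => // n; exact: leq_pmulr.
Qed.

Lemma enorm_eq0 x : enorm x = 0 -> x = 0.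
Proof.
move=> x0; have /eqP : dotp x x = 0 by rewrite -enorm_sqr x0 expr0n.
rewrite psumr_eq0 => [/allP h|i _]; last by rewrite -expr2 sqr_ge0.
apply/rowP => i; have /implyP/(_ isT) := h i (mem_index_enum i).
by rewrite -expr2 sqrf_eq0 mxE => /eqP.
Qed.

(** Pairing [x + y] with its own direction gives its norm exactly, and [dotp_unit_le] bounds the two
    summands. A null sum has no direction and is treated first. *)
Lemma enormD x y : enorm (x + y) <= enorm x + enorm y.
Proof.
have [/enorm_eq0->|n0] := eqVneq (enorm (x + y)) 0.
  by rewrite enorm0 addr_ge0 ?enorm_ge0.
set s := enorm (x + y) in n0 *.
have u1 : enorm (s^-1 *: (x + y)) = 1.
  by rewrite enormZ ger0_norm ?invr_ge0 ?enorm_ge0// mulVf.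
have -> : s = dotp (s^-1 *: (x + y)) (x + y).
  by rewrite dotpC dotpZr -enorm_sqr expr2 mulKf.
by rewrite dotpDr lerD// dotp_unit_le.
Qed.

End euclidean_theory.

Lemma unit_vector_ex (R : realType) (d : nat) :
  (0 < d)%N -> exists u : 'rV[R]_d, enorm u = 1.
Proof.
case: d => // d _; exists (delta_mx ord0 ord0).
rewrite /enorm /dotp big_ord_recl big1 => [|i _]; rewrite !mxE ?eqxx//=.
- by rewrite mulr1 addr0 sqrtr1.
- by rewrite mulr0.
Qed.

(** * Borel measurability in [R^d] *)

Section borel_rV_measurability.
Context {R : realType} {d : nat}.
Local Notation E := (borel_rV R d).

Lemma open_borel_measurable (A : set E) : @open 'rV[R]_d A -> measurable A.
Proof. by move=> oA; exact: sub_sigma_algebra. Qed.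

Lemma measurable_rV_coord (i : 'I_d) :
  measurable_fun [set: E] (fun x : E => (x : 'rV[R]_d) ord0 i).
Proof.
apply: (measurability _ (RGenOpens.measurableE R)) => _ [_ [a [b ->] <-]].
rewrite setTI; apply: open_borel_measurable.
have /continuousP cc : continuous (fun x : 'rV[R]_d => x ord0 i).
  exact: coord_continuous.
exact/cc/interval_open.
Qed.

(** Second countability: the index set is countable. A rational ball of radius below [e / 2] that
    contains [x] stays inside the [e]-ball about [x]. *)
Lemma open_rV_bigcup_rat (A : set 'rV[R]_d) : open A ->
  A = \bigcup_(q in [set q : 'rV[rat]_d * rat |
         ball (map_mx ratr q.1 : 'rV[R]_d) (ratr q.2) `<=` A])
      ball (map_mx ratr q.1 : 'rV[R]_d) (ratr q.2).
Proof.
move=> oA; apply/seteqP; split => [x Ax|x [q /= qA qx]]; last exact: qA.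
have /nbhs_ballP[e /= e0 xeA] : nbhs x A by exact: open_nbhs_nbhs.
have /rat_in_itvoo[r /itvP r0e] : 0 < e / 2 by rewrite divr_gt0.
have r0 : 0 < ratr r :> R by rewrite r0e.
have cex (i : 'I_d) : exists c : rat, `|ratr c - x ord0 i| < ratr r :> R.
  have /rat_in_itvoo[c /itvP cx] : x ord0 i - ratr r < x ord0 i + ratr r.
    by rewrite ltrD2l (lt_trans _ r0)// oppr_lt0.
  exists c; have c1 : x ord0 i - ratr r < ratr c by rewrite cx.
  have c2 : ratr c < x ord0 i + ratr r by rewrite cx.
  by rewrite ltr_distl c1 c2.
have [c cP] := choice cex.
have xc : ball (map_mx ratr (\row_i c i) : 'rV[R]_d) (ratr r) x.
  by split => // i j; rewrite (ord1 i) !mxE; exact: cP.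
exists (\row_i c i, r) => //= y cy; apply: xeA.
have re : ratr r + ratr r <= e.
  have : ratr r < e / 2 by rewrite r0e.
  by lra.
apply: (le_ball re); apply: ball_triangle cy.
exact: ball_sym.
Qed.

(** Balls of the sup norm are boxes, so the preimage of a rational ball is a finite intersection of
    coordinate preimages. *)
Lemma measurable_fun_rV d' (T : measurableType d') (f : T -> E) :
  (forall i, measurable_fun setT (fun t => (f t : 'rV[R]_d) ord0 i)) ->
  measurable_fun setT f.
Proof.
move=> mf; apply: (@measurability _ _ _ E setT f (@open 'rV[R]_d)) => // _ [A oA <-].
rewrite setTI (open_rV_bigcup_rat oA) preimage_bigcup bigcup_mkcond.
apply: countable_bigcupT_measurable => [|q]; first exact: countableP.
(* A matrix ball of nonpositive radius is empty by definition; for [d = 0] the coordinate conditions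
   alone would be vacuous. *)
case: ifPn => // _; have [q0|q0] := ltP 0 (ratr q.2 : R); last first.
  rewrite (_ : _ @^-1` _ = set0)//; apply/seteqP; split => // t [].
  by rewrite ltNge q0.
rewrite (_ : _ @^-1` _ = \bigcap_(i in [set: 'I_d])
  ((fun t => (f t : 'rV[R]_d) ord0 i) @^-1` ball (ratr (q.1 ord0 i) : R) (ratr q.2))).
  apply: fin_bigcap_measurable => // i _; rewrite -[X in measurable X]setTI.
  by apply: mf => //; exact: measurable_ball.
apply/seteqP; split => t /=.
  by move=> [_ h] i _; have := h ord0 i; rewrite mxE.
by move=> h; split => // i j; rewrite (ord1 i) mxE; exact: h.
Qed.

Context d' (T : measurableType d').
Implicit Types (f g : T -> 'rV[R]_d) (h : T -> R).

Lemma measurable_fun_coord f i : measurable_fun setT (f : T -> E) ->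
  measurable_fun setT (fun t => f t ord0 i).
Proof.
by move=> mf; exact: (measurableT_comp (@measurable_rV_coord i) mf).
Qed.

Lemma measurable_fun_rVD f g :
  measurable_fun setT (f : T -> E) -> measurable_fun setT (g : T -> E) ->
  measurable_fun setT ((fun t => f t + g t) : T -> E).
Proof.
move=> mf mg; apply: measurable_fun_rV => i.
under eq_fun do rewrite mxE.
by apply: measurable_funD; exact: measurable_fun_coord.
Qed.

Lemma measurable_fun_rVZ h g :
  measurable_fun setT h -> measurable_fun setT (g : T -> E) ->
  measurable_fun setT ((fun t => h t *: g t) : T -> E).
Proof.
move=> mf mg; apply: measurable_fun_rV => i.
under eq_fun do rewrite mxE.
by apply: measurable_funM => //; exact: measurable_fun_coord.
Qed.

Lemma measurable_fun_rVB f g :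
  measurable_fun setT (f : T -> E) -> measurable_fun setT (g : T -> E) ->
  measurable_fun setT ((fun t => f t - g t) : T -> E).
Proof.
move=> mf mg; apply: measurable_fun_rVD => //.
under eq_fun do rewrite -scaleN1r.
exact: measurable_fun_rVZ.
Qed.

Lemma measurable_fun_dotp f g :
  measurable_fun setT (f : T -> E) -> measurable_fun setT (g : T -> E) ->
  measurable_fun setT (fun t => dotp (f t) (g t)).
Proof.
move=> mf mg; apply: measurable_sum => i.
by apply: measurable_funM; exact: measurable_fun_coord.
Qed.

Lemma measurable_fun_enorm f :
  measurable_fun setT (f : T -> E) -> measurable_fun setT (fun t => enorm (f t)).
Proof.
move=> mf; have ms : measurable_fun [set: R] (@Num.sqrt R).
  by apply: continuous_measurable_fun; exact: sqrt_continuous.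
exact: (measurableT_comp ms (measurable_fun_dotp mf mf)).
Qed.

Lemma measurable_edist f g :
  measurable_fun setT (f : T -> E) -> measurable_fun setT (g : T -> E) ->
  measurable_fun setT (fun t => (enorm (f t - g t))%:E).
Proof.
move=> mf mg; apply/measurable_EFinP/measurable_fun_enorm.
exact: measurable_fun_rVB.
Qed.

End borel_rV_measurability.

Lemma measurable_halfspace (R : realType) (d : nat) (u z : 'rV[R]_d) :
  measurable (halfspace u z).
Proof.
have mf : measurable_fun [set: borel_rV R d] (fun x => dotp u ((x : 'rV[R]_d) - z)).
  by apply: measurable_fun_dotp => //; exact: measurable_fun_rVB.
have := mf measurableT _ (@measurable_itv R `[0, +oo[).
rewrite setTI; congr measurable; apply/seteqP.
by split => x /=; rewrite in_itv/= andbT.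
Qed.

(** * Mixtures and image laws *)

Section probability_constructions.
Context {R : realType} {d : measure_display} {T : measurableType d}.
Implicit Types (P Q : probability T R).
Local Open Scope ereal_scope.

(** The integral formula is recorded with the law because it is applied to laws on [E * E], to
    compute the cost of a mixed coupling. *)
Lemma mixture_ex (t : R) P Q : (0 <= t)%R -> (t <= 1)%R ->
  exists M : probability T R,
    (forall A, M A = t%:E * P A + (1 - t)%:E * Q A) /\
    (forall f : T -> \bar R, measurable_fun setT f -> (forall x, 0 <= f x) ->
      \int[M]_x f x = t%:E * \int[P]_x f x + (1 - t)%:E * \int[Q]_x f x).
Proof.
move=> t0; rewrite -subr_ge0 => t1.
pose mu : {measure set T -> \bar R} :=
  measure_add (mscale (NngNum t0) P) (mscale (NngNum t1) Q).
have muE A : mu A = t%:E * P A + (1 - t)%:E * Q A by exact: measure_addE.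
have mu1 : mu setT = 1%E.
  by rewrite muE !probability_setT !mule1 -EFinD addrC subrK.
pose M : probability T R := HB.pack (Measure.sort mu) (Measure.class mu)
  (Measure_isProbability.Build _ _ _ mu mu1).
exists M; split => [A|f mf f0]; first exact: muE.
rewrite (_ : M = mu :> (set T -> \bar R))// ge0_integral_measure_add//.
by rewrite !ge0_integral_mscale.
Qed.

Lemma image_law_ex d' (T' : measurableType d') (X : T -> T') P :
  measurable_fun setT X ->
  exists M : probability T' R,
    (forall A, M A = P (X @^-1` A)) /\
    (forall f : T' -> \bar R, measurable_fun setT f -> (forall x, 0 <= f x) ->
      \int[M]_y f y = \int[P]_x f (X x)).
Proof.
move=> mX; pose Xm : {mfun T >-> T'} :=
  HB.pack X (isMeasurableFun.Build _ _ _ _ _ mX).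
exists (distribution P Xm); split => // f mf f0.
exact: ge0_integral_distribution.
Qed.

Lemma probability_EFin P A : measurable A -> P A = (fine (P A))%:E.
Proof. by move=> mA; rewrite fineK// fin_num_measure. Qed.

End probability_constructions.

(** * Wasserstein distance *)

Section wasserstein_theory.
Context {R : realType} {d : nat}.
Local Notation E := (borel_rV R d).
Implicit Types (P Q M : probability E R) (u z h : 'rV[R]_d).
Local Open Scope ereal_scope.

Lemma measurable_cost :
  measurable_fun [set: E * E] (fun w => (enorm ((w.1 : 'rV[R]_d) - w.2)%R)%:E).
Proof. exact: measurable_edist. Qed.

(** Random vectors with the right laws on any common probability space bound the distance: the law
    of the pair [(X, Y)] is a coupling. *)
Lemma wasserstein_le d' (O : measurableType d') (mu : probability O R)
    (X Y : O -> 'rV[R]_d) P Q :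
  measurable_fun setT (X : O -> E) -> measurable_fun setT (Y : O -> E) ->
  (forall A : set E, measurable A -> mu (X @^-1` A) = Q A) ->
  (forall A : set E, measurable A -> mu (Y @^-1` A) = P A) ->
  wasserstein Q P <= \int[mu]_o (enorm (X o - Y o)%R)%:E.
Proof.
move=> mX mY XQ YP.
have mXY : measurable_fun setT ((fun o => (X o, Y o)) : O -> E * E).
  exact: measurable_fun_pair.
have [Pi [PiE PiI]] := image_law_ex mu mXY.
apply: ereal_inf_lbound; exists Pi => /=.
  by move=> A mA; rewrite !PiE; split; [exact: XQ|exact: YP].
rewrite PiI//; first exact: measurable_cost.
by move=> w; rewrite lee_fin enorm_ge0.
Qed.

Lemma wasserstein_lt_ex P Q a : wasserstein Q P < a ->
  exists2 Pi, is_coupling Q P Pi &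
    \int[Pi]_w (enorm ((w.1 : 'rV[R]_d) - w.2)%R)%:E < a.
Proof. by move=> /ereal_inf_lt[_ [Pi cPi <-] lt_a]; exists Pi. Qed.

Lemma wasserstein_self P (a : R) : (0 <= a)%R -> wasserstein P P <= a%:E.
Proof.
move=> a0; apply: le_trans (_ : 0 <= _); last by rewrite lee_fin.
have mid : measurable_fun setT (idfun : E -> E) by exact: measurable_id.
apply: le_trans (wasserstein_le (mu := P) mid mid _ _) _ => //.
by under eq_integral do rewrite subrr enorm0; rewrite integral0.
Qed.

(** Near-optimal couplings are mixed with the same weights; the second marginal remains [P] because
    the weights add up to 1. *)
Lemma wasserstein_mixture (t a b : R) P Q1 Q2 M : (0 <= t)%R -> (t <= 1)%R ->
  (forall A, M A = t%:E * Q1 A + (1 - t)%:E * Q2 A) ->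
  wasserstein Q1 P <= a%:E -> wasserstein Q2 P <= b%:E ->
  wasserstein M P <= (t * a + (1 - t) * b)%:E.
Proof.
move=> t0 t1 ME W1 W2; apply/lee_addgt0Pr => e e0.
have lt_e (c : R) : c%:E < (c + e)%:E by rewrite lte_fin ltrDl.
have [Pi1 c1 I1] := wasserstein_lt_ex (le_lt_trans W1 (lt_e a)).
have [Pi2 c2 I2] := wasserstein_lt_ex (le_lt_trans W2 (lt_e b)).
have [Pi [PiE PiI]] := mixture_ex Pi1 Pi2 t0 t1.
apply: le_trans (wasserstein_le (mu := Pi) measurable_fst measurable_snd _ _) _.
- move=> A mA; rewrite PiE ME.
  by have [-> _] := c1 A mA; have [-> _] := c2 A mA.
- move=> A mA; rewrite PiE; have [_ ->] := c1 A mA; have [_ ->] := c2 A mA.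
  by rewrite -ge0_muleDl ?lee_fin ?subr_ge0// -EFinD addrC subrK mul1e.
rewrite PiI; [|exact: measurable_cost|by move=> w; rewrite lee_fin enorm_ge0].
have -> : (t * a + (1 - t) * b)%:E + e%:E =
    t%:E * (a + e)%:E + (1 - t)%:E * (b + e)%:E.
  by rewrite -!EFinM -!EFinD; congr EFin; ring.
by apply: leeD; apply: lee_wpmul2l; rewrite ?lee_fin ?subr_ge0//; exact: ltW.
Qed.

(** Shifting the first coordinate of a near-optimal coupling adds at most [enorm h] to the cost
    pointwise. *)
Lemma wasserstein_translate (a : R) h P Q M :
  (forall A : set E, M A = Q ((fun x : 'rV[R]_d => x + h)%R @^-1` A)) ->
  wasserstein Q P <= a%:E -> wasserstein M P <= (a + enorm h)%:E.
Proof.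
move=> ME W; apply/lee_addgt0Pr => e e0.
have ltae : wasserstein Q P < (a + e)%:E.
  by rewrite (le_lt_trans W)// lte_fin ltrDl.
have [Pi cPi IPi] := wasserstein_lt_ex ltae.
have mh : measurable_fun setT ((fun x : 'rV[R]_d => x + h)%R : E -> E).
  exact: measurable_fun_rVD.
have mX : measurable_fun setT
    ((fun w : E * E => ((w.1 : 'rV[R]_d) + h)%R) : E * E -> E).
  exact: measurable_fun_rVD.
apply: le_trans (wasserstein_le (mu := Pi) mX measurable_snd _ _) _.
- move=> A mA; rewrite ME.
  have mA' : measurable ((fun x : 'rV[R]_d => x + h)%R @^-1` A : set E).
    by rewrite -[X in measurable X]setTI; exact: mh.
  by have [<- _] := cPi _ mA'.
- by move=> A mA; have [_ ->] := cPi A mA.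
apply: (@le_trans _ _ (\int[Pi]_w
    ((enorm ((w.1 : 'rV[R]_d) - w.2)%R)%:E + (enorm h)%:E))).
  apply: ge0_le_integral => //.
  - by move=> w _; rewrite lee_fin enorm_ge0.
  - exact: measurable_edist.
  - by apply: emeasurable_funD => //; exact: measurable_cost.
  - by move=> w _; rewrite -EFinD lee_fin addrAC enormD.
rewrite ge0_integralD//; last 3 first.
- by move=> w _; rewrite lee_fin enorm_ge0.
- exact: measurable_cost.
- by move=> w _; rewrite lee_fin enorm_ge0.
- rewrite integral_cst// [X in _ * X](_ : _ = 1); last exact: probability_setT.
  rewrite mule1 (_ : (a + _)%:E + _ = (a + e)%:E + (enorm h)%:E).
    by apply: leeD => //; exact: ltW.
  by rewrite -!EFinD addrAC.
Qed.

Definition cball z (r : R) : set E := [set x : 'rV[R]_d | (enorm (x - z) <= r)%R].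

Lemma cball_bool_measurable z r :
  measurable_fun [set: E] (fun x : E => (enorm ((x : 'rV[R]_d) - z) <= r)%R).
Proof.
apply: measurable_fun_ler => //; apply: measurable_fun_enorm.
exact: measurable_fun_rVB.
Qed.

Lemma measurable_cball z r : measurable (cball z r).
Proof.
rewrite -[X in measurable X]setTI.
exact: (@cball_bool_measurable z r measurableT [set true]).
Qed.

(* All the mass of the ball is moved to its centre, which lies in every
   halfspace through [z]. *)
Lemma collapse_ball_ex z (r : R) P : (0 <= r)%R ->
  exists2 Q, wasserstein Q P <= r%:E &
    forall u, P (cball z r) <= Q (halfspace u z).
Proof.
move=> r0; pose phi (x : 'rV[R]_d) := if (enorm (x - z) <= r)%R then z else x.
have mphi : measurable_fun setT (phi : E -> E).
  by apply: measurable_fun_ifT => //; exact: cball_bool_measurable.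
have [Q [QE _]] := image_law_ex P mphi.
exists Q => [|u].
  have mid : measurable_fun setT (idfun : E -> E) by exact: measurable_id.
  apply: le_trans (wasserstein_le (mu := P) mphi mid _ _) _ => //.
  (* Each point moves by at most [r], and the total mass is 1. *)
  rewrite -[leRHS]mule1 -(probability_setT P) -integral_cst//.
  apply: ge0_le_integral => //.
  - by move=> w _; rewrite lee_fin enorm_ge0.
  - exact: measurable_edist.
  - move=> x _; rewrite lee_fin /phi; case: ifPn => [|_].
      by rewrite enormB_sym.
    by rewrite subrr enorm0.
rewrite QE; apply: le_measure; rewrite ?inE.
- exact: measurable_cball.
- rewrite -[X in measurable X]setTI; apply: mphi => //.
  exact: measurable_halfspace.
- move=> x /= xr; rewrite /phi /halfspace/= xr subrr.
  by rewrite -(subrr 0%R) dotpBr subrr.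
Qed.

(** Continuity from below along integer radii. The lower bound [r0] allows [r] to exceed [delta], so
    that [delta / r] can serve as a mixing weight. *)
Lemma cball_mass_gt z (a r0 : R) P : (a < 1)%R ->
  exists2 r : R, (r0 <= r)%R & a%:E < P (cball z r).
Proof.
move=> a1.
have Ucball : \bigcup_n cball z n%:R = setT.
  apply/seteqP; split => // x _.
  exists (Num.truncn (enorm ((x : 'rV[R]_d) - z)%R)).+1 => //.
  exact/ltW/truncnS_gt.
have cv : P (cball z n%:R) @[n --> \oo] --> P (\bigcup_n cball z n%:R).
  apply: nondecreasing_cvg_mu => [n||n m nm].
  - exact: measurable_cball.
  - by rewrite Ucball.
  - apply/subsetPset => x /= xn; apply: le_trans xn _.
    by rewrite ler_nat.
rewrite Ucball probability_setT in cv.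
have [n an rn] : exists2 n : nat, a%:E < P (cball z n%:R) & (r0 <= n%:R)%R.
  near \oo => n; exists n; near: n.
    have a1E : a%:E < 1%:E by rewrite lte_fin.
    exact: (cv _ (open_ereal_gt' a1E)).
  exact: nbhs_infty_ger.
by exists n%:R.
Unshelve. all: by end_near. Qed.

End wasserstein_theory.

(** * Averaging and retracting couplings *)

Section coupling_moves.
Context {R : realType} {d : nat}.
Local Notation E := (borel_rV R d).
Implicit Types (P Q M : probability E R) (u z h : 'rV[R]_d).
Local Open Scope ereal_scope.

(** The trade behind the scaling, positivity and level-set arguments: transport budget and mass of a
    fixed set average with the same weights. *)
Lemma mixture_wasserstein_ex (t a b x y : R) P Q1 Q2 (A : set E) :
  (0 <= t)%R -> (t <= 1)%R ->
  wasserstein Q1 P <= a%:E -> x%:E <= Q1 A ->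
  wasserstein Q2 P <= b%:E -> y%:E <= Q2 A ->
  exists2 M, wasserstein M P <= (t * a + (1 - t) * b)%:E &
    (t * x + (1 - t) * y)%:E <= M A.
Proof.
move=> t0 t1 W1 xA W2 yA; have [M [ME _]] := mixture_ex Q1 Q2 t0 t1.
exists M; first exact: wasserstein_mixture W1 W2.
by rewrite ME EFinD !EFinM leeD// lee_wpmul2l// lee_fin subr_ge0.
Qed.

(* Writing [w = (y, x)] with [y] distributed as [Q] and [x] as [P], the point
   [y] is replaced by [x + max(0, <u, y - x> - e) u]: its component along [u]
   drops by at most [e], and [e] is saved wherever [<u, y - x>] exceeds [e]. *)
Lemma retract_coupling_ex u z (e : R) P Q (Pi : probability (E * E)%type R) :
  enorm u = 1%R -> (0 <= e)%R -> is_coupling Q P Pi ->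
  exists Q' (p : R), [/\
    wasserstein Q' P + (e * p)%:E <=
      \int[Pi]_w (enorm ((w.1 : 'rV[R]_d) - w.2)%R)%:E,
    Q (halfspace u (z + e *: u)%R) <= Q' (halfspace u z) &
    Q (halfspace u (z + e *: u)%R) <= P (halfspace u z) + p%:E].
Proof.
move=> u1 e0 cPi.
have uu : dotp u u = 1%R by rewrite -enorm_sqr u1 expr1n.
pose g (w : E * E) := dotp u ((w.1 : 'rV[R]_d) - w.2)%R.
pose s (w : E * E) := Num.max 0%R (g w - e)%R.
pose f (w : E * E) : 'rV[R]_d := ((w.2 : 'rV[R]_d) + s w *: u)%R.
pose A := [set w | (e < g w)%R].
have mg : measurable_fun setT g.
  by apply: measurable_fun_dotp => //; exact: measurable_fun_rVB.
have ms : measurable_fun setT s.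
  by apply: measurable_maxr => //; exact: measurable_funB.
have mf : measurable_fun setT (f : E * E -> E).
  by apply: measurable_fun_rVD => //; exact: measurable_fun_rVZ.
have mA : measurable A.
  rewrite -[A]setTI.
  by have := measurable_fun_ltr (measurable_cst e) mg measurableT (Y := [set true]); exact.
have s0 w : (0 <= s w)%R by rewrite /s le_max lexx.
have [Q' [Q'E _]] := image_law_ex Pi mf.
have mH z' := measurable_halfspace u z'.
have mfst z' : measurable (fst @^-1` halfspace u z' : set (E * E)).
  by rewrite -[X in measurable X]setTI; exact: measurable_fst.
have msnd z' : measurable (snd @^-1` halfspace u z' : set (E * E)).
  by rewrite -[X in measurable X]setTI; exact: measurable_snd.
have Qfst z' : Q (halfspace u z') = Pi (fst @^-1` halfspace u z').
  by have [-> _] := cPi _ (mH z').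
(* Here [p] is the mass that the coupling displaces by more than [e] along [u]. *)
exists Q', (fine (Pi A)); split.
- apply: (@le_trans _ _ (\int[Pi]_w (s w)%:E + (e * fine (Pi A))%:E)).
    rewrite leeD2r//.
    apply: le_trans (wasserstein_le (mu := Pi) mf measurable_snd _ _) _ => //.
      by move=> B mB; have [_ ->] := cPi B mB.
    apply: ge0_le_integral => //.
    + by move=> w _; rewrite lee_fin enorm_ge0.
    + exact: measurable_edist.
    + exact/measurable_EFinP.
    + move=> w _; rewrite lee_fin /f addrAC subrr add0r enormZ u1 mulr1.
      by rewrite ger0_norm.
  have -> : (e * fine (Pi A))%:E = \int[Pi]_w (e%:E * (\1_A w)%:E).
    rewrite ge0_integralZl//.
    + by rewrite integral_indic// setIT EFinM -probability_EFin.
    + by apply/measurable_EFinP; exact: measurable_indic.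
  have mi : measurable_fun setT (fun w => e%:E * (\1_A w)%:E).
    by apply: emeasurable_funM => //; apply/measurable_EFinP; exact: measurable_indic.
  rewrite -ge0_integralD//; last 3 first.
  + by move=> w _; rewrite lee_fin.
  + exact/measurable_EFinP.
  + by move=> w _; rewrite -EFinM lee_fin mulr_ge0.
  (* Pointwise [s + e * 1_A] is at most the cost: on [A] it equals [g], bounded by Cauchy-Schwarz,
     and off [A] it vanishes. *)
  apply: ge0_le_integral => //.
  + by move=> w _; rewrite -EFinM -EFinD lee_fin addr_ge0// mulr_ge0.
  + by apply: emeasurable_funD => //; exact/measurable_EFinP.
  + exact: measurable_cost.
  + move=> w _; rewrite -EFinM -EFinD lee_fin indicE /s.
    have gw : (g w <= enorm ((w.1 : 'rV[R]_d) - w.2))%R by exact: dotp_unit_le.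
    have n0 := enorm_ge0 ((w.1 : 'rV[R]_d) - w.2)%R.
    have [wA|wA] := boolP (w \in A).
      move: wA; rewrite inE /A/= => eg; rewrite max_r ?subr_ge0 ?(ltW eg)//.
      by rewrite mulr1 subrK.
    move: wA; rewrite notin_setE /A/= => /negP; rewrite -leNgt => ge.
    by rewrite max_l ?subr_le0// mulr0 addr0.
- rewrite Qfst Q'E; apply: le_measure; rewrite ?inE//.
    by rewrite -[X in measurable X]setTI; exact: mf.
  move=> w; rewrite /halfspace/= /f /s /g !(dotpDr, dotpNr, dotpZr) uu => H.
  have : (dotp u w.1 - dotp u w.2 - e <=
    Num.max 0 (dotp u w.1 - dotp u w.2 - e))%R by rewrite le_max lexx orbT.
  by lra.
- rewrite Qfst; have [_ <-] := cPi _ (mH z).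
  rewrite -probability_EFin//; apply: le_trans (measureU2 _ _ _) => //.
  apply: le_measure; rewrite ?inE//; first exact: measurableU.
  (* If the first point clears the level of [z] by [e] and the second lies below that level, their
     gap along [u] exceeds [e]. *)
  move=> w; rewrite /halfspace/= /A/= /g !(dotpDr, dotpNr, dotpZr) uu => H.
  by have [wz|wz] := leP 0%R (dotp u w.2 - dotp u z)%R; [left|right; lra].
Qed.

End coupling_moves.

(** * Robustified depth *)

Section robust_depth_theory.
Context {R : realType} {d : nat}.
Local Notation E := (borel_rV R d).
Context (P : probability E R) (d_gt0 : (0 < d)%N).
Implicit Types (u z h : 'rV[R]_d) (delta : R).

Lemma robust_depth_ge delta z (c : R) :
  (forall u, enorm u = 1 -> exists2 Q : probability E R,
     (wasserstein Q P <= delta%:E)%E & (c%:E <= Q (halfspace u z))%E) ->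
  (c%:E <= robust_depth delta z P)%E.
Proof.
move=> H; apply: le_ereal_inf_tmp => _ [u /= u1 <-]; have [Q WQ cQ] := H u u1.
by apply: le_trans cQ _; apply: ereal_sup_ubound; exists Q.
Qed.

Lemma robust_depth_gt_ex delta z (c : R) u : enorm u = 1 ->
  (c%:E < robust_depth delta z P)%E ->
  exists2 Q : probability E R,
    (wasserstein Q P <= delta%:E)%E & (c%:E < Q (halfspace u z))%E.
Proof.
move=> u1 cD; have : (c%:E < ereal_sup [set Q (halfspace u z)
    | Q in [set Q | (wasserstein Q P <= delta%:E)%E]])%E.
  by apply: lt_le_trans cD _; apply: ereal_inf_lbound; exists u.
by move=> /ereal_sup_gt[_ [Q WQ <-] cQ]; exists Q.
Qed.

Lemma robust_depth_ge0 delta z : 0 <= delta -> (0 <= robust_depth delta z P)%E.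
Proof.
by move=> d0; apply: robust_depth_ge => u _; exists P => //; exact: wasserstein_self.
Qed.

Lemma robust_depth_le1 delta z : (robust_depth delta z P <= 1)%E.
Proof.
have [u u1] := unit_vector_ex R d_gt0.
apply: (@le_trans _ _ (ereal_sup [set Q (halfspace u z)
    | Q in [set Q | (wasserstein Q P <= delta%:E)%E]])).
  by apply: ereal_inf_lbound; exists u.
apply: ge_ereal_sup => _ [Q _ <-].
by apply: probability_le1; exact: measurable_halfspace.
Qed.

(** A real version, so that the estimates are ordinary arithmetic; [rdepthE] shows that [fine] loses
    nothing for [0 <= delta]. *)
Definition rdepth delta z : R := fine (robust_depth delta z P).

Lemma rdepthE delta z : 0 <= delta -> robust_depth delta z P = (rdepth delta z)%:E.
Proof.
move=> d0; rewrite fineK// ge0_fin_numE ?robust_depth_ge0//.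
by rewrite (le_lt_trans (robust_depth_le1 _ _)) ?ltry.
Qed.

Lemma rdepth_ge0 delta z : 0 <= delta -> 0 <= rdepth delta z.
Proof. by move=> d0; rewrite -lee_fin -rdepthE// robust_depth_ge0. Qed.

Lemma rdepth_le1 delta z : 0 <= delta -> rdepth delta z <= 1.
Proof. by move=> d0; rewrite -lee_fin -rdepthE// robust_depth_le1. Qed.

Lemma rdepth_gt_ex delta z (e : R) u : 0 <= delta -> 0 < e -> enorm u = 1 ->
  exists2 Q : probability E R, (wasserstein Q P <= delta%:E)%E &
    ((rdepth delta z - e)%:E <= Q (halfspace u z))%E.
Proof.
move=> d0 e0 u1.
have lt_e : ((rdepth delta z - e)%:E < robust_depth delta z P)%E.
  by rewrite rdepthE// lte_fin ltrBlDr ltrDl.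
by have [Q WQ /ltW cQ] := robust_depth_gt_ex u1 lt_e; exists Q.
Qed.

(** * Monotonicity, scaling, translation and the Lipschitz bound *)

Lemma rdepth_mono delta delta' z : 0 <= delta -> delta <= delta' ->
  rdepth delta z <= rdepth delta' z.
Proof.
move=> d0 dd'; apply/ler_addgt0Pr => e e0.
rewrite -lerBlDr -lee_fin -rdepthE ?(le_trans d0)//.
apply: robust_depth_ge => u u1; have [Q WQ cQ] := rdepth_gt_ex z d0 e0 u1.
by exists Q => //; rewrite (le_trans WQ)// lee_fin.
Qed.

(** For each direction a near-optimal law receives weight [t] and [P], which costs nothing, the
    rest. *)
Lemma rdepth_scale (t : R) delta z : 0 <= t -> t <= 1 -> 0 <= delta ->
  t * rdepth delta z <= rdepth (t * delta) z.
Proof.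
move=> t0 t1 d0; apply/ler_addgt0Pr => e e0.
rewrite -lerBlDr -lee_fin -rdepthE ?mulr_ge0//.
apply: robust_depth_ge => u u1; have [Q WQ cQ] := rdepth_gt_ex z d0 e0 u1.
have P0 : (0%:E <= P (halfspace u z))%E by [].
have [M WM cM] := mixture_wasserstein_ex t0 t1 WQ cQ (wasserstein_self P (lexx 0)) P0.
exists M; first by move: WM; rewrite mulr0 addr0.
by apply: le_trans cM; rewrite lee_fin; nra.
Qed.

Lemma rdepth_translate delta z h : 0 <= delta ->
  rdepth delta z <= rdepth (delta + enorm h) (z + h).
Proof.
move=> d0; apply/ler_addgt0Pr => e e0.
rewrite -lerBlDr -lee_fin -rdepthE ?addr_ge0 ?enorm_ge0//.
apply: robust_depth_ge => u u1; have [Q WQ cQ] := rdepth_gt_ex z d0 e0 u1.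
have mh : measurable_fun setT ((fun x : 'rV[R]_d => x + h) : E -> E).
  exact: measurable_fun_rVD.
have [M [ME _]] := image_law_ex Q mh.
exists M; first exact: wasserstein_translate WQ.
rewrite ME (_ : _ @^-1` _ = halfspace u z)//; apply/seteqP.
by split => x; rewrite /halfspace/= opprD addrACA subrr addr0.
Qed.

(** Scaling passes from [delta] to [delta' - e] at [z], then translation passes from [z] to [z']
    with the remaining budget [e]. *)
Lemma rdepth_lipschitz delta delta' z z' : 0 < delta -> 0 < delta' ->
  delta * (rdepth delta z - rdepth delta' z') <=
  `|delta - delta'| + enorm (z' - z).
Proof.
move=> d0 d0'; set e := enorm (z' - z).
have e0 : 0 <= e by exact: enorm_ge0.
have a1 : delta - delta' <= `|delta - delta'| by exact: ler_norm.
have D1 := rdepth_le1 z (ltW d0); have D0 := rdepth_ge0 z' (ltW d0').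
(* If [delta' <= e], the right side is at least [delta], and depths differ by at most 1. *)
have [de|de] := leP delta' e.
  by have := normr_ge0 (delta - delta'); nra.
have tr : rdepth (delta' - e) z <= rdepth delta' z'.
  have := @rdepth_translate (delta' - e) z (z' - z).
  rewrite subr_ge0 -/e subrK (addrC z) subrK; apply; exact: ltW.
have [dd|dd] := leP delta (delta' - e).
  have := rdepth_mono z (ltW d0) dd; have := normr_ge0 (delta - delta').
  by nra.
have t0 : 0 <= (delta' - e) / delta by rewrite divr_ge0 ?subr_ge0// ltW.
have t1 : (delta' - e) / delta <= 1 by rewrite ler_pdivrMr// mul1r ltW.
have := rdepth_scale z t0 t1 (ltW d0); rewrite divfK ?gt_eqF// => sc.
have {}sc : (delta' - e) * rdepth delta z <= delta * rdepth (delta' - e) z.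
  by move: sc; rewrite mulrAC ler_pdivrMr// [leRHS]mulrC.
nra.
Qed.

Lemma rdepth_dist_le delta delta' z z' : 0 < delta -> 0 < delta' ->
  Num.min delta delta' * `|rdepth delta z - rdepth delta' z'| <=
  `|delta - delta'| + enorm (z - z').
Proof.
move=> d0 d0'.
have H1 := rdepth_lipschitz z z' d0 d0'; have H2 := rdepth_lipschitz z' z d0' d0.
rewrite enormB_sym in H1; rewrite distrC in H2.
have m0 : 0 <= Num.min delta delta' by rewrite le_min !ltW.
have m1 : Num.min delta delta' <= delta by rewrite ge_min lexx.
have m2 : Num.min delta delta' <= delta' by rewrite ge_min lexx orbT.
have [D|D] := leP (rdepth delta' z') (rdepth delta z).
  rewrite ger0_norm ?subr_ge0//; apply: le_trans H1.
  by rewrite ler_wpM2r// subr_ge0.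
rewrite ltr0_norm ?subr_lt0// opprB; apply: le_trans H2.
by rewrite ler_wpM2r// subr_ge0 ltW.
Qed.

(** With weight [delta / r] the collapsed law costs exactly [delta], and its contribution
    [delta / r * m] does not depend on [u]. *)
Lemma robust_depth_gt0 delta z : 0 < delta -> (0 < robust_depth delta z P)%E.
Proof.
move=> d0; have [r rd mr] := cball_mass_gt z delta P (@ltr01 R).
have r0 : 0 < r by exact: lt_le_trans rd.
have [Q WQ cQ] := collapse_ball_ex z P (ltW r0).
rewrite (probability_EFin _ (measurable_cball z r)) in mr cQ.
set m := fine _ in mr cQ; have m0 : 0 < m by rewrite -lte_fin.
have t0 : 0 <= delta / r by rewrite divr_ge0 ?ltW.
have t1 : delta / r <= 1 by rewrite ler_pdivrMr// mul1r.
apply: (@lt_le_trans _ _ (delta / r * m)%:E).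
  by rewrite lte_fin mulr_gt0// divr_gt0.
apply: robust_depth_ge => u u1.
have P0 : (0%:E <= P (halfspace u z))%E by [].
have [M] := mixture_wasserstein_ex t0 t1 WQ (cQ u) (wasserstein_self P (lexx 0)) P0.
by rewrite !mulr0 !addr0 divfK ?gt_eqF// => WM cM; exists M.
Qed.

(* Either the retracted law is cheaper by [k], or the law [P] itself nearly
   reaches [alpha]; the slack is spent on collapsing a ball onto [z]. *)
Lemma robust_depth_gt_of_ball delta alpha (e : R) z :
  0 < delta -> alpha < 1 -> 0 < e ->
  (forall u, enorm u = 1 -> (alpha%:E <= robust_depth delta (z + e *: u) P)%E) ->
  (alpha%:E < robust_depth delta z P)%E.
Proof.
move=> d0 a1 e0 Dge; have [r rd mr] := cball_mass_gt z delta P a1.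
have r0 : 0 < r by exact: lt_le_trans rd.
have [Qr WQr cQr] := collapse_ball_ex z P (ltW r0).
rewrite (probability_EFin _ (measurable_cball z r)) in mr cQr.
set m := fine _ in mr cQr; rewrite lte_fin in mr.
pose g := m - alpha; have g0 : 0 < g by rewrite subr_gt0.
pose t2 := delta / r.
have t20 : 0 < t2 by rewrite divr_gt0.
have t21 : t2 <= 1 by rewrite ler_pdivrMr// mul1r.
(* The second bound on [k] ensures that [e * p < 2 * k] forces [p <= t2 * g / 4]. The weights [t1]
   and [t2] are those at which collapsing costs [k] and [delta]. *)
pose k := Num.min delta (t2 * g * e / 8).
have t2g : 0 < t2 * g by exact: mulr_gt0.
have k0 : 0 < k by rewrite lt_min d0/= divr_gt0// mulr_gt0.
have kd : k <= delta by rewrite ge_min lexx.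
have kg : k <= t2 * g * e / 8 by rewrite ge_min lexx orbT.
pose t1 := k / r.
have t10 : 0 < t1 by rewrite divr_gt0.
have t12 : t1 <= t2 by rewrite ler_pM2r ?invr_gt0.
have t11 : t1 <= 1 by exact: le_trans t21.
have t1r : t1 * r = k by rewrite divfK ?gt_eqF.
have t2r : t2 * r = delta by rewrite divfK ?gt_eqF.
(* The gain [c] is fixed before [u], so that it survives the infimum over directions. *)
pose c := t1 * g / 4; have c0 : 0 < c by rewrite divr_gt0// mulr_gt0.
have c2 : c <= t2 * g / 4 by rewrite ler_pM2r ?invr_gt0// ler_pM2r.
apply: (@lt_le_trans _ _ (alpha + c)%:E); first by rewrite lte_fin ltrDl.
apply: robust_depth_ge => u u1.
have lt_c : ((alpha - c)%:E < robust_depth delta (z + e *: u) P)%E.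
  by apply: lt_le_trans (Dge _ u1); rewrite lte_fin ltrBlDr ltrDl.
have [Q WQ cQ] := robust_depth_gt_ex u1 lt_c.
(* The coupling may overspend by [k]; a saving of [2 * k] then still leaves a law within
   [delta - k]. *)
have WQk : (wasserstein Q P < (delta + k)%:E)%E.
  by apply: le_lt_trans WQ _; rewrite lte_fin ltrDl.
have [Pi cPi IPi] := wasserstein_lt_ex WQk.
have [Q' [p [WQ' QQ' QP]]] := retract_coupling_ex z u1 (ltW e0) cPi.
have [kp|kp] := leP (2 * k) (e * p).
  have W' : (wasserstein Q' P <= (delta - k)%:E)%E.
    have := le_lt_trans WQ' IPi; rewrite -lteBrDr// -EFinB => /ltW/le_trans; apply.
    by rewrite lee_fin; lra.
  have c' := le_trans (ltW cQ) QQ'.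
  have [M WM cM] := mixture_wasserstein_ex (ltW t10) t11 WQr (cQr u) W' c'.
  exists M.
    apply: le_trans WM _; rewrite lee_fin t1r.
    by have := mulr_ge0 (ltW t10) (_ : 0 <= delta - k); rewrite subr_ge0 => /(_ kd); lra.
  apply: le_trans cM; rewrite lee_fin.
  have -> : t1 * m + (1 - t1) * (alpha - c) = alpha + t1 * g - c + t1 * c.
    by rewrite /g; ring.
  have := mulr_ge0 (ltW t10) (ltW c0); have : t1 * g = 4 * c by rewrite /c; field.
  by lra.
(* Little mass was displaced by more than [e], so [P] itself nearly reaches [alpha] and the whole
   budget [delta] is free for collapsing. *)
have p2 : p <= t2 * g / 4.
  rewrite -(ler_pM2l e0) (le_trans (ltW kp))//; move: kg.
  have -> : e * (t2 * g / 4) = 2 * (t2 * g * e / 8) by field.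
  by lra.
have cP : ((alpha - c - t2 * g / 4)%:E <= P (halfspace u z))%E.
  have := lt_le_trans cQ QP.
  rewrite (probability_EFin _ (measurable_halfspace u z)) -EFinD lte_fin lee_fin.
  by lra.
have [M WM cM] := mixture_wasserstein_ex (ltW t20) t21 WQr (cQr u)
  (wasserstein_self P (lexx 0)) cP.
exists M; first by apply: le_trans WM _; rewrite mulr0 addr0 t2r.
apply: le_trans cM; rewrite lee_fin.
have -> : t2 * m + (1 - t2) * (alpha - c - t2 * g / 4) =
    alpha + t2 * g - c - t2 * g / 4 + t2 * (c + t2 * g / 4).
  by rewrite /g; field.
have : 0 <= t2 * (c + t2 * g / 4).
  by apply: mulr_ge0; [exact: ltW|apply: addr_ge0; [exact: ltW|lra]].
by lra.
Qed.

(** * Joint continuity *)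

Lemma rdepth_continuous (p : 'rV[R]_d * R) : 0 < p.2 ->
  {for p, continuous (fun q : 'rV[R]_d * R => rdepth q.2 q.1)}.
Proof.
case: p => z delta /= d0; apply/cvgrPdist_le => e e0.
have n0 : 0 < (d%:R + 1 : R) by rewrite ltr_wpDl.
(* The bound [delta / 2] keeps [delta'] away from 0. In [d%:R + 1], the [d] comes from comparing
   Euclidean and sup norms, the 1 from the change in [delta]. *)
pose r := Num.min (delta / 2) (e * delta / (2 * (d%:R + 1))).
have r0 : 0 < r.
  by rewrite lt_min !divr_gt0// mulr_gt0.
exists (ball z r, ball delta r) => /=; first by split; exact: nbhsx_ballx.
move=> [z' delta'] [/= zz' dd'].
have r1 : r <= delta / 2 by rewrite ge_min lexx.
have r2 : (d%:R + 1) * r <= e * (delta / 2).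
  have -> : e * (delta / 2) = (d%:R + 1) * (e * delta / (2 * (d%:R + 1))).
    by field; rewrite gt_eqF.
  by rewrite ler_pM2l// ge_min lexx orbT.
have dd : `|delta - delta'| < r by exact: dd'.
have zr : enorm (z - z') <= d%:R * r.
  apply: le_trans (enorm_le_norm _) _; rewrite ler_wpM2l//.
  by move: zz'; rewrite mx_norm_ball => /ltW.
have d2 : delta / 2 <= delta'.
  by move: dd; rewrite ltr_norml => /andP[_]; lra.
have d0' : 0 < delta' by lra.
have lip := rdepth_dist_le z z' d0 d0'.
have d20 : 0 < delta / 2 by rewrite divr_gt0.
have dm : delta / 2 <= Num.min delta delta'.
  by rewrite le_min d2 andbT; lra.
rewrite -(ler_pM2r d20) (le_trans _ r2)// mulrC.
apply: le_trans (ler_wpM2r (normr_ge0 _) dm) _; apply: le_trans lip _.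
by rewrite mulrDl mul1r addrC lerD// ltW.
Qed.

Lemma rdepth_continuous_point delta : 0 < delta -> continuous (rdepth delta).
Proof.
move=> d0 z.
apply: (@continuous_comp _ _ _ (fun z' : 'rV[R]_d => (z', delta))
  (fun q => rdepth q.2 q.1)).
  move=> A [[U V] /= [Uz Vd] UVA]; apply: filterS Uz => z' Uz'.
  by apply: UVA; split => //; exact: nbhs_singleton Vd.
exact: rdepth_continuous.
Qed.

End robust_depth_theory.

(** * Positivity, joint continuity and level sets *)

Theorem proposition3 (R : realType) (d : nat) (hd : (1 <= d)%N)
    (P : probability (borel_rV R d) R) :
  (forall delta : R, 0 < delta ->
     forall z : 'rV[R]_d, (0 < robust_depth delta z P)%E) /\
  {within [set p : 'rV[R]_d * R | 0 < p.2],
     continuous (fun p : 'rV[R]_d * R => robust_depth p.2 p.1 P)} /\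
  (forall delta : R, 0 < delta -> forall alpha : R, 0 < alpha < 1 ->
     let level := [set z : 'rV[R]_d | robust_depth delta z P = alpha%:E] in
     let upper := [set z : 'rV[R]_d | (alpha%:E <= robust_depth delta z P)%E] in
     level = boundary upper \/ (level = set0 /\ upper = set0)).
Proof.
split; first by move=> delta d0 z; exact: robust_depth_gt0.
split.
  have oA : open [set p : 'rV[R]_d * R | 0 < p.2].
    apply: (@open_comp _ _ (@snd 'rV[R]_d R) [set x | 0 < x]).
      by move=> p _; exact: cvg_snd.
    exact: open_gt.
  rewrite continuous_open_subspace// => p; rewrite inE/= => p0.
  rewrite /continuous_at (rdepthE _ hd)//; last exact: ltW.
  have cv : (rdepth P q.2 q.1)%:E @[q --> p] --> (rdepth P p.2 p.1)%:E.
    by apply: cvg_EFin; [exact: nearW|exact: rdepth_continuous].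
  (* The extended and the real depth are known to agree only for nonnegative radii, hence near
     [p]. *)
  apply: cvg_trans cv; apply: near_eq_cvg.
  have : \forall q \near p, 0 < q.2 by exact: open_nbhs_nbhs.
  by apply: filterS => q q0; rewrite rdepthE// ltW.
(* The first alternative always holds: an empty upper set has empty boundary. *)
move=> delta d0 alpha /andP[a0 a1] level upper; left.
have DE z : robust_depth delta z P = (rdepth P delta z)%:E.
  by apply: rdepthE => //; exact: ltW.
have cD : continuous (rdepth P delta) by exact: rdepth_continuous_point.
have upperE : upper = rdepth P delta @^-1` [set x | alpha <= x].
  by apply/seteqP; split => z; rewrite /upper/= DE lee_fin.
have clU : closed upper.
  rewrite upperE; apply: closed_comp => [z _|]; first exact: cD.
  exact: closed_ge.
have opU : open (rdepth P delta @^-1` [set x | alpha < x]).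
  by apply: open_comp => [z _|]; [exact: cD|exact: open_gt].
rewrite /boundary -(closure_id upper).1//; apply/seteqP; split => z.
- move=> lz; split; first by rewrite /upper/= lz.
  move=> /nbhs_ballP[e /= e0 zeU].
  have : (alpha%:E < robust_depth delta z P)%E.
    have e20 : 0 < e / 2 by rewrite divr_gt0.
    (* An interior point of value [alpha] would be a local minimum. The points [z + (e / 2) u] lie
       in the open sup-norm ball because the coordinates of [u] are at most 1 in absolute value. *)
    apply: (robust_depth_gt_of_ball (e := e / 2)) => // u u1.
    apply: zeU; split => // i j; rewrite (ord1 i) !mxE /ball/= opprD addNKr.
    rewrite normrN normrM gtr0_norm//.
    have := coord_le_enorm u j; rewrite u1 => uj.
    have uje : e / 2 * `|u ord0 j| <= e / 2 * 1 by rewrite ler_pM2l.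
    by apply: le_lt_trans uje _; rewrite mulr1 ltr_pdivrMr// ltr_pMr// ltr1n.
  by rewrite lz ltxx.
(* A depth strictly above [alpha] would persist nearby and make [z] an interior point. *)
- move=> [Uz nUz]; apply/eqP; rewrite eq_le; apply/andP; split => //.
  rewrite leNgt; apply/negP => az; apply: nUz.
  have : nbhs z (rdepth P delta @^-1` [set x | alpha < x]).
    by apply: open_nbhs_nbhs; split => //=; rewrite -lte_fin -DE.
  by apply: filterS => y /= ay; rewrite /upper/= DE lee_fin ltW.
Qed.
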